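(* Let $G$ be a connected graph with $n$ vertices and $m$ edges. Then $$MS_1(G)\ \le\ \sqrt{m\left\{MSD^{3/2}(G)+2\,MS_2(G)\right\}},$$ with equality if and only if $\sigma(u)+\sigma(v)$ is constant over all edges $uv\in E(G)$.
   Context: All graphs are finite and simple. $d(u)$ is the degree of a vertex $u$; $d(u,v)$ is the graph distance; the transmission of $v$ is $\sigma(v)=\sum_{u\in V(G)}d(v,u)$. Define $MS_1(G)=\sum_{uv\in E(G)}(\sigma(u)+\sigma(v))$, $MS_2(G)=\sum_{uv\in E(G)}\sigma(u)\sigma(v)$, and $MSD^{3/2}(G)=\sum_{u\in V(G)}d(u)\sigma(u)^2$ (the superscript is an index parameter, not a power). *)

(* Defs.v *)
From mathcomp Require Import all_boot all_order all_algebra.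

Set Implicit Arguments.
Unset Strict Implicit.
Unset Printing Implicit Defensive.

Record sgraph := SGraph {
  vertex :> finType;
  adj : rel vertex;
  adj_sym : symmetric adj;
  adj_irrefl : irreflexive adj
}.

Section Graph.

Variable G : sgraph.
Implicit Types (u v : G) (A : {set G}).

(* Edges are unordered: each one is the two-element set of its end points. *)
Definition edges : {set {set G}} :=
  [set A | [exists u, exists v, adj u v && (A == [set u; v])]].

Definition connected : Prop :=
  0 < #|G| /\ forall u v, connect (@adj G) u v.

Definition degree u : nat := #|[set v | adj u v]|.

Definition walk (k : nat) u v : bool :=
  [exists p : k.-tuple G, path (@adj G) u p && (last u p == v)].

(* Least length of a walk from u to v. If v is reachable from u, some walk has
   length < #|G|, so restricting to k < #|G| loses nothing; otherwise the value
   is the junk value #|G|. *)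
Definition dist u v : nat := \big[minn/#|G|]_(k < #|G| | walk k u v) k.

Definition transmission v : nat := \sum_(u : G) dist v u.

(* An edge A = {u, v} has exactly two elements, so the inner sum (product) over
   A is transmission u + transmission v (transmission u * transmission v). *)
Definition MS1 : nat := \sum_(A in edges) \sum_(u in A) transmission u.

Definition MS2 : nat := \sum_(A in edges) \prod_(u in A) transmission u.

(* MSD^{3/2}: the 3/2 is an index parameter, not an exponent. *)
Definition MSD32 : nat := \sum_(u : G) degree u * transmission u ^ 2.

End Graph.

(* Main.v *)
Require Import Defs.
From mathcomp Require Import all_boot all_order all_algebra.
From mathcomp Require Import ring.

(** Write [s A] for the sum of the transmissions of the end points of the edge
    [A], so that [MS1] is the sum of [s] over the [m] edges.  Squaring [s A]
    and summing over the edges produces the cross terms [2 * MS2] and, for each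
    vertex [u], the term [transmission u ^ 2] once per edge at [u], that is
    [degree u] times; hence [MSD32 + 2 * MS2] is the sum of the squares of [s]
    ([sum_sqr_edge_transmission]).  The inequality is then the Cauchy-Schwarz
    inequality between [s] and the constant function 1 on the set of edges,
    whose defect is half the sum of the squares of all differences
    [s A - s B] ([sum_sqr_sub]); it vanishes exactly when [s] is constant. *)

Import Order.TTheory GRing.Theory Num.Theory.
Local Open Scope ring_scope.

(** * The Cauchy-Schwarz inequality against a constant *)

(** Lagrange's identity when one of the two families is constantly 1. *)
Lemma sum_sqr_sub (R : comNzRingType) (T : finType) (S : {set T}) (f : T -> R) :
  \sum_(x in S) \sum_(y in S) (f x - f y) ^+ 2 =
  (#|S|%:R * (\sum_(x in S) f x ^+ 2) - (\sum_(x in S) f x) ^+ 2) *+ 2.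
Proof.
have -> : \sum_(x in S) \sum_(y in S) (f x - f y) ^+ 2 =
    \sum_(x in S) (#|S|%:R * f x ^+ 2 + \sum_(y in S) f y ^+ 2
                   - 2%:R * (\sum_(y in S) f y) * f x).
  apply: eq_bigr => x _.
  rewrite mulr_natl -sumr_const mulrAC mulr_sumr -big_split -sumrB /=.
  by apply: eq_bigr => y _; ring.
rewrite sumrB big_split -!mulr_sumr sumr_const -mulr_natl /=.
by ring.
Qed.

Lemma sqr_sum_le (R : realDomainType) (T : finType) (S : {set T}) (f : T -> R) :
  (\sum_(x in S) f x) ^+ 2 <= #|S|%:R * (\sum_(x in S) f x ^+ 2).
Proof.
rewrite -subr_ge0 -(pmulrn_lge0 _ (ltn0Sn 1)) -sum_sqr_sub.
by apply: sumr_ge0 => x _; apply: sumr_ge0 => y _; apply: sqr_ge0.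
Qed.

Lemma sqr_sum_eq (R : realDomainType) (T : finType) (S : {set T}) (f : T -> R) :
  (\sum_(x in S) f x) ^+ 2 = #|S|%:R * (\sum_(x in S) f x ^+ 2) <->
  {in S &, forall x y, f x = f y}.
Proof.
have sqr_ge0S x : 0 <= \sum_(y in S) (f x - f y) ^+ 2.
  by apply: sumr_ge0 => y _; apply: sqr_ge0.
split=> [eq_sum x y Sx Sy | f_const]; last first.
  apply/esym/eqP; rewrite -subr_eq0 -[_ == 0]/((2 == 0)%N || _) -mulrn_eq0.
  rewrite -sum_sqr_sub.
  apply/eqP/big1 => x Sx; apply: big1 => y Sy.
  by rewrite (f_const x y) // subrr expr0n.
have /eqP := sum_sqr_sub R T S f; rewrite -eq_sum subrr mul0rn.
rewrite psumr_eq0 // => /allP/(_ x (mem_index_enum _))/implyP/(_ Sx).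
rewrite psumr_eq0 => [|z _]; last exact: sqr_ge0.
move=> /allP/(_ y (mem_index_enum _))/implyP/(_ Sy).
by rewrite sqrf_eq0 subr_eq0 => /eqP.
Qed.

(** * Sums over the edges of a graph *)

Lemma edgesP (G : sgraph) (A : {set G}) :
  reflect (exists u v : G, adj u v /\ A = [set u; v]) (A \in edges G).
Proof.
rewrite inE; apply: (iffP existsP) => [[u /existsP[v /andP[uv /eqP->]]]|].
  by exists u, v.
by case=> u [v [uv ->]]; exists u; apply/existsP; exists v; rewrite uv eqxx.
Qed.

Lemma adj_neq {G : sgraph} {u v : G} : adj u v -> u != v.
Proof. by apply: contraTneq => ->; rewrite adj_irrefl. Qed.

(** The edges at [u] are the sets [[set u; v]] for the neighbours [v] of [u],
    and the other end point [v] is determined by the edge. *)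
Lemma card_edges_at (G : sgraph) (u : G) :
  #|[set A in edges G | u \in A]| = degree u.
Proof.
have -> : [set A in edges G | u \in A] =
          [set [set u; v] | v in [set v | adj u v]].
  apply/setP=> A; rewrite in_set; apply/andP/imsetP => [[/edgesP]|].
    case=> x [y [xy ->]]; rewrite !inE => /orP[] /eqP->.
      by exists y; rewrite ?inE.
    by exists x; rewrite 1?setUC // inE adj_sym.
  case=> v; rewrite inE => uv ->; split; last by rewrite !inE eqxx.
  by apply/edgesP; exists u, v.
apply: card_in_imset => v w; rewrite !inE => uv _ /setP/(_ v).
by rewrite !inE eqxx orbT eq_sym (negPf (adj_neq uv)) => /esym/eqP.
Qed.

(** Double counting of the pairs of an edge and one of its end points. *)
Lemma sum_edges_endpoints (G : sgraph) (f : G -> nat) :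
  (\sum_(A in edges G) \sum_(u in A) f u = \sum_(u : G) degree u * f u)%N.
Proof.
rewrite (exchange_big_dep predT) //=; apply: eq_bigr => u _.
by rewrite sum_nat_const -card_edges_at cardsE.
Qed.

Definition edge_transmission {G : sgraph} (A : {set G}) : nat :=
  (\sum_(u in A) transmission u)%N.

Lemma edge_transmission2 (G : sgraph) (u v : G) : adj u v ->
  edge_transmission [set u; v] = (transmission u + transmission v)%N.
Proof.
by move=> uv; rewrite /edge_transmission big_setU1 ?big_set1 // inE adj_neq.
Qed.

Lemma sum_sqr_edge_transmission (G : sgraph) :
  (\sum_(A in edges G) edge_transmission A ^ 2 = MSD32 G + 2 * MS2 G)%N.
Proof.
rewrite /MSD32 -sum_edges_endpoints /MS2 big_distrr -big_split /=.
apply: eq_bigr => A /edgesP[u [v [uv ->]]].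
by rewrite edge_transmission2 // !big_setU1 ?inE ?adj_neq // !big_set1 sqrnD.
Qed.

Lemma edge_transmission_const (G : sgraph) :
  {in edges G &, forall A B, edge_transmission A = edge_transmission B} <->
  exists c : nat, forall u v : G, adj u v ->
    (transmission u + transmission v)%N = c.
Proof.
split=> [s_const | [c sE] A B].
  have [E0 | [A EA]] := set_0Vmem (edges G); last first.
    exists (edge_transmission A) => u v uv; rewrite -edge_transmission2 //.
    by apply: s_const => //; apply/edgesP; exists u, v.
  (* In a graph without edges any constant will do. *)
  exists 0%N => u v uv.
  have : [set u; v] \in edges G by apply/edgesP; exists u, v.
  by rewrite E0 inE.
move=> /edgesP[u [v [uv ->]]] /edgesP[x [y [xy ->]]].
by rewrite !edge_transmission2 // !sE.
Qed.

(** * The bound on the first transmission index *)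

Theorem proposition13 (R : rcfType) (G : sgraph) (n m : nat)
    (Gconn : connected G) (Gn : #|G| = n) (Gm : #|edges G| = m) :
  (MS1 G)%:R <= Num.sqrt (m%:R * ((MSD32 G)%:R + 2%:R * (MS2 G)%:R)) :> R
  /\ ((MS1 G)%:R = Num.sqrt (m%:R * ((MSD32 G)%:R + 2%:R * (MS2 G)%:R)) :> R
      <-> exists c : nat, forall u v : G, adj u v ->
            (transmission u + transmission v)%N = c).
Proof.
pose s (A : {set G}) : R := (edge_transmission A)%:R.
have MS1E : (MS1 G)%:R = \sum_(A in edges G) s A by rewrite natr_sum.
have sqrE : (MSD32 G)%:R + 2%:R * (MS2 G)%:R = \sum_(A in edges G) s A ^+ 2.
  rewrite -natrM -natrD -sum_sqr_edge_transmission natr_sum.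
  by apply: eq_bigr => A _; rewrite natrX.
have MS1_sqrt : (MS1 G)%:R = Num.sqrt ((MS1 G)%:R ^+ 2) :> R.
  by rewrite sqrtr_sqr normr_nat.
have rhs_ge0 : 0 <= #|edges G|%:R * \sum_(A in edges G) s A ^+ 2.
  by apply: le_trans (sqr_sum_le R _ (edges G) s); apply: sqr_ge0.
rewrite -Gm sqrE; split.
  by rewrite MS1_sqrt MS1E ler_wsqrtr // sqr_sum_le.
apply: iff_trans (edge_transmission_const G).
have s_inj : {in edges G &, forall A B, s A = s B} <->
    {in edges G &, forall A B, edge_transmission A = edge_transmission B}.
  split=> s_const A B EA EB; last by rewrite /s (s_const A B).
  by apply/eqP; rewrite -(eqr_nat R); apply/eqP; apply: s_const.
apply: iff_trans s_inj; apply: iff_trans (sqr_sum_eq R _ (edges G) s).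
rewrite -MS1E; split=> [-> | eq_sqr]; first by rewrite sqr_sqrtr.
by rewrite MS1_sqrt eq_sqr.
Qed.
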